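(* Let $n\ge2$, $m\ge2$ be integers with $m\ge\sqrt n$, let $B_1,\ldots,B_m$ be mutually unbiased orthonormal bases of $\mathbb{C}^n$, and let $\mathfrak{B}=\bigsqcup_{i=1}^m B_i$. Let $p$ be a positive integer with $y=\frac pn\in(0,1)$. Let $\Omega_p$ be the set of all maps $s:\{1,\ldots,p\}\to\mathfrak{B}$ with the uniform probability, and for $s\in\Omega_p$ let $\mathcal{G}(s)$ be the $p\times p$ matrix with $(i,j)$-entry $\langle s(i),s(j)\rangle$. For a positive integer $l$ set $A_l(s)=\frac1p\mathrm{Tr}\big(\mathcal{G}(s)^l\big)$. Then for every fixed positive integer $l$, $$\mathbb{E}\big(A_l(s),\Omega_p\big)=\sum_{i=0}^{l-1}\frac{y^i}{i+1}\binom{l}{i}\binom{l-1}{i}+O_l\!\left(\frac1m+\frac1n\right),$$ where the implied constant depends only on $l$.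
   Context: Orthonormal bases $B_1,\ldots,B_m$ of $\mathbb{C}^n$ are mutually unbiased if $|\langle u,v\rangle|=\frac{1}{\sqrt n}$ for all $u\in B_i$, $v\in B_j$, $i\ne j$, where $\langle\cdot,\cdot\rangle$ is the standard Hermitian inner product. $\mathbb{E}(\cdot,\Omega_p)$ denotes expectation with respect to the uniform probability on $\Omega_p$ (equivalently, $s(1),\ldots,s(p)$ are chosen uniformly and independently from the $mn$ vectors of $\mathfrak{B}$). *)

(* Defs.v *)
From mathcomp Require Import all_boot all_order all_algebra.
From mathcomp Require Import complex.
From mathcomp Require Import reals.
Set Implicit Arguments. Unset Strict Implicit. Unset Printing Implicit Defensive.
Import Order.TTheory GRing.Theory Num.Theory.
Local Open Scope ring_scope.
Local Open Scope complex_scope.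

Section Defs.
Variable R : realType.
Local Notation C := (R[i]).

Definition hinner n (u v : 'rV[C]_n) : C := \sum_(k < n) u 0 k * (v 0 k)^*.

Definition orthonormal_basis n (b : 'I_n -> 'rV[C]_n) : Prop :=
  forall k k', hinner (b k) (b k') = (k == k')%:R.

Definition mutually_unbiased n m (B : 'I_m -> 'I_n -> 'rV[C]_n) : Prop :=
  (forall i, orthonormal_basis (B i)) /\
  (forall i j, i != j -> forall k k',
     `| hinner (B i k) (B j k') | = 1 / sqrtC (n%:R : C)).

(* Omega_p = maps {1..p} -> frakB, frakB = disjoint union indexed by 'I_m * 'I_n *)
Definition Gram n m p (B : 'I_m -> 'I_n -> 'rV[C]_n)
  (s : {ffun 'I_p -> 'I_m * 'I_n}) : 'M[C]_p :=
  \matrix_(i, j) hinner (B (s i).1 (s i).2) (B (s j).1 (s j).2).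

Definition A_l n m p (B : 'I_m -> 'I_n -> 'rV[C]_n) (l : nat)
  (s : {ffun 'I_p -> 'I_m * 'I_n}) : C :=
  (p%:R)^-1 * \tr (Gram B s ^+ l).

Definition expect_Al n m p (B : 'I_m -> 'I_n -> 'rV[C]_n) (l : nat) : C :=
  (#|{ffun 'I_p -> 'I_m * 'I_n}|%:R)^-1 *
  \sum_(s : {ffun 'I_p -> 'I_m * 'I_n}) A_l B l s.

Definition main_term (y : C) (l : nat) : C :=
  \sum_(i < l) y ^+ i / (i.+1)%:R * ('C(l, i))%:R * ('C(l.-1, i))%:R.
End Defs.

(* Main.v *)
(* Expanding the trace, E(A_l) is 1/p times the sum, over cyclic words of length
   l in the letters 1..p, of the expectation of the product of the inner products
   along the word. A pair of equal adjacent letters can be contracted, and, since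
   the union of the bases is a tight frame, a letter that occurs once can be
   deleted at the cost of a factor 1/n. A noncrossing word with k letters thus has
   expectation exactly n^(1-k). Any other word reduces to one in which no
   two cyclically adjacent letters are equal and every letter occurs at least
   twice. If s takes c >= 2 values on its k letters, then at least 3c - k
   of the inner products join different vectors, hence are at most n^(-1/2), while
   a proportion O((mn)^(c-k)) of the s take c values; as n <= m^2 this bounds
   the contribution by O(n^(-k)). The case c = 1 contributes O((mn)^(1-k)), which
   is where the error 1/m comes from. Finally the noncrossing words are counted by
   the height of the stack of open blocks, which gives the Narayana numbers. *)
Require Import Defs.
From mathcomp Require Import all_boot all_order all_algebra.
From mathcomp Require Import complex.
From mathcomp Require Import reals.
From mathcomp Require Import zify ring.
Set Implicit Arguments. Unset Strict Implicit. Unset Printing Implicit Defensive.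
Import Order.TTheory GRing.Theory Num.Theory.

(** * Noncrossing words and their reductions *)

Section Noncrossing.
Variable T : finType.
Implicit Types (x y z : T) (S v : seq T) (u : {set T}).

(** The letter [y] itself stays on top. The default [[::]] is never reached from [noncrossing],
    which pops only letters of the stack. *)
Fixpoint pop y S := if S is z :: S' then if z == y then S else pop y S' else [::].

(* Reads [v] with the stack [S] of open blocks (the current one on top) and the
   set [u] of letters already met: returning to an older block closes the blocks
   above it, and a letter whose block is closed may not occur again. *)
Fixpoint noncrossing S u v :=
  if v is y :: v' then
    if y \in S then noncrossing (pop y S) u v'
    else (y \notin u) && noncrossing (y :: S) (y |: u) v'
  else true.

(** Computed in step with [noncrossing]. For [u = [set x]] it is the exponent k - 1 of 1/n attached
    to a word [x :: v] with k letters. *)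
Fixpoint fresh u v : nat :=
  if v is y :: v' then (y \notin u) + fresh (y |: u) v' else 0.

Lemma pop_suffix y S : exists S', S = S' ++ pop y S.
Proof.
elim: S => [|z S [S' IH]] /=; first by exists [::].
case: ifP => _; first by exists [::].
by exists (z :: S'); rewrite /= -IH.
Qed.

Lemma mem_pop y S : {subset pop y S <= S}.
Proof. by have [S' {2}->] := pop_suffix y S; move=> z zS; rewrite mem_cat zS orbT. Qed.

Lemma uniq_pop y S : uniq S -> uniq (pop y S).
Proof. by have [S' {1}->] := pop_suffix y S; rewrite cat_uniq => /and3P[]. Qed.

Lemma pop_filter x y S : y != x ->
  filter (predC1 x) (pop y S) = pop y (filter (predC1 x) S).
Proof.
move=> yx; elim: S => //= z S IH.
have [->|zy] := eqVneq z y; first by rewrite /= yx /= eqxx.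
by case: (z != x) => /=; rewrite ?(negPf zy) IH.
Qed.

Lemma pop_rcons x y S : y \in rcons S x ->
  exists S', pop y (rcons S x) = rcons S' x.
Proof.
elim: S => [|z S IH] /=.
  by rewrite inE => /eqP->; exists [::]; rewrite eqxx.
by rewrite inE eq_sym; case: eqP => [-> _|_ /IH //]; exists (y :: S).
Qed.

Lemma fresh_card u v : #|u :|: [set z in v]| = #|u| + fresh u v.
Proof.
elim: v u => [|y v IH] u /=.
  by rewrite addn0; apply: eq_card => z; rewrite !inE orbF.
have -> : u :|: [set z in y :: v] = (y |: u) :|: [set z in v].
  by apply/setP => z; rewrite !inE; case: (z == y); rewrite ?orbT.
by rewrite IH cardsU1 addnA (addnC #|u|).
Qed.

(** A letter just read is on top of the stack, so reading it again pops nothing. *)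
Lemma noncrossing_dup S u v1 y v2 :
  noncrossing S u (v1 ++ y :: y :: v2) = noncrossing S u (v1 ++ y :: v2).
Proof.
elim: v1 S u => [|z v1 IH] S u /=; last by rewrite !IH.
case: ifP => [yS|_]; last by rewrite inE eqxx.
suff [S' ->] : exists S', pop y S = y :: S' by rewrite inE /= eqxx.
elim: S yS => //= z S IH; rewrite inE eq_sym.
by case: eqP => [-> _|_ /= /IH]; first by exists S.
Qed.

(** The bottom block is never popped, so its letter may always be read at the end. This is
    contraction across the end of a cyclic word. *)
Lemma noncrossing_rcons_bottom S x u v :
  noncrossing (rcons S x) u (rcons v x) = noncrossing (rcons S x) u v.
Proof.
elim: v S u => [|y v IH] S u /=; first by rewrite mem_rcons inE eqxx.
case: ifP => [yS|_]; last by rewrite -rcons_cons IH.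
by have [S' ->] := pop_rcons yS; rewrite IH.
Qed.

(** A letter absent from [v] is never looked up, neither on the stack nor among the letters met. *)
Lemma noncrossing_filter x S u v : x \notin v ->
  noncrossing S u v = noncrossing (filter (predC1 x) S) (u :\ x) v.
Proof.
elim: v S u => //= y v IH S u; rewrite inE negb_or eq_sym => /andP[yx xv].
rewrite mem_filter /= yx /= in_setD1 yx /=.
case: ifP => _; first by rewrite IH // pop_filter.
rewrite IH //= yx; congr (_ && noncrossing _ _ _).
by apply/setP => z; rewrite !inE; case: (eqVneq z y) => [->|]; rewrite ?yx.
Qed.

(** Once read, a lone letter sits on the stack without being returned to, and [noncrossing_filter]
    erases it. *)
Lemma noncrossing_singleton x S u v1 v2 :
  x \notin S -> x \notin u -> x \notin v1 ++ v2 ->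
  noncrossing S u (v1 ++ x :: v2) = noncrossing S u (v1 ++ v2).
Proof.
elim: v1 S u => [|y v1 IH] S u xS xu /=.
  move=> xv; rewrite (negPf xS) xu /= (noncrossing_filter _ _ xv) /= eqxx /=.
  rewrite setU1K //; congr noncrossing.
  by apply/all_filterP/allP => z zS /=; apply: contraNneq xS => <-.
rewrite inE negb_or => /andP[xy xv].
case: ifP => _; first by rewrite IH //; apply: contra (@mem_pop y S x) xS.
by rewrite IH // ?inE ?negb_or ?xy ?in_setU1 ?negb_or ?xy.
Qed.

Lemma noncrossing_notin S u y v :
  noncrossing S u v -> y \in u -> y \notin S -> y \notin v.
Proof.
elim: v S u => //= z v IH S u; rewrite inE negb_or eq_sym.
case: ifP => [zS nc yu yS|_ /andP[zu nc] yu yS].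
  have -> : z != y by apply: contraNneq yS => <-.
  by apply: IH nc yu _; apply: contra yS; apply: mem_pop.
have zy : z != y by apply: contraNneq zu => ->.
rewrite zy; apply: IH nc _ _; first by rewrite !inE yu orbT.
by rewrite inE negb_or eq_sym zy.
Qed.

(* The last block opened before the first return to an older one is a
   singleton. *)
Lemma noncrossing_exists_singleton S u y v :
  noncrossing (y :: S) u v -> y \in u -> y \notin S ->
  path (fun a b => a != b) y v ->
  exists2 t, count_mem t (y :: v) = 1 & (t == y) || (t \notin u).
Proof.
elim: v S u y => [|z v IH] S u y /=.
  by move=> _ _ _ _; exists y; rewrite /= eqxx.
move=> nc yu yS /andP[yz pv]; move: nc; rewrite inE eq_sym (negPf yz) /=.
case: ifP => [zS nc|/negbT zS /andP[zu nc]].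
  exists y; rewrite ?eqxx //= eq_sym (negPf yz).
  have /count_memPn -> // := noncrossing_notin nc yu (contra (@mem_pop z S y) yS).
have zyS : z \notin y :: S by rewrite inE negb_or eq_sym yz.
have [|t t1 tz] := IH _ _ _ nc _ zyS pv; first by rewrite !inE eqxx.
have tu : t \notin u.
  by case/orP: tz => [/eqP-> //|]; rewrite !inE negb_or => /andP[].
exists t; last by rewrite tu orbT.
have -> : y == t = false by apply: contraNF tu => /eqP <-.
by rewrite add0n.
Qed.
End Noncrossing.

(** * Counting noncrossing words by stack height *)

(* Number of continuations of length [L] opening [i] new blocks, from a stack of
   height [h]. *)
Fixpoint nc_count (L i h : nat) : nat :=
  if L is L'.+1 then
    (if i is i'.+1 then nc_count L' i' h.+1 else 0)
      + \sum_(j < h) nc_count L' i j.+1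
  else i == 0.

Lemma nc_count_gt L i h : L < i -> nc_count L i h = 0.
Proof.
elim: L i h => [|L IH] [|i] h //= Li; rewrite IH // add0n.
by rewrite big1 // => j _; rewrite IH // ltnW.
Qed.

(** A ballot-type difference of products of binomials at height g + 1, with the negative term moved
    to the left to stay in [nat]. *)
Lemma nc_count_closed L i g :
  nc_count L i g.+1 + (if i is i'.+1 then 'C(L, i') * 'C(L + g, g + i.+1) else 0)
  = 'C(L, i) * 'C(L + g, g + i).
Proof.
elim: L i g => [|L IH] i g.
  case: i => [|i] /=; first by rewrite addn0 bin0 add0n addn0 binn.
  by rewrite add0n (@bin_small (0 + g)) ?muln0 ?bin0n //; lia.
elim: g => [|g IHg].
  rewrite /= big_ord1 /=; case: i => [|i].
    by have := IH 0 0; rewrite ?addn0 ?add0n ?bin0 => ->.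
  have := IH i 1; have := IH i.+1 0.
  rewrite ?add0n ?addn0 ?addn1 ?add1n.
  case: i => [|i]; rewrite !binS ?bin0. lia. lia.
(* The recursions at heights g + 1 and g + 2 differ by few terms, so at most three instances of [IH]
   and Pascal's rule suffice. *)
move: IHg; rewrite /= !big_ord_recr /=.
have := IH i g.+1; case: i => [|i].
  by rewrite ?addn0 ?addSn ?addnS !binS !bin0; lia.
have := IH i g.+2; have := IH i g.+1; rewrite ?addSn ?addnS.
by case: i => [|i]; rewrite ?addnS ?addn0 !binS ?bin0; lia.
Qed.

(** At height 1 the closed form is C(L,i)^2 - C(L,i-1) C(L,i+1); the ratios of consecutive binomials
    turn it into a Narayana number. *)
Lemma nc_count_narayana L i : i <= L ->
  nc_count L i 1 * i.+1 = 'C(L.+1, i) * 'C(L, i).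
Proof.
move=> iL; have := nc_count_closed L i 0; rewrite !addn0 !add0n.
case: i iL => [|i] iL; first by rewrite !bin0; lia.
move=> E; have := mul_bin_left L i; have := mul_bin_left L i.+1.
move: E; rewrite binS; set a := 'C(L, i); set b := 'C(L, i.+1); set c := 'C(L, i.+2).
move: (nc_count _ _ _) => t E Ec Eb.
suff : t * i.+2 + a * c * i.+2 = (b + a) * b + a * c * i.+2 by lia.
have -> : a * c * i.+2 = a * ((L - i.+1) * b) by rewrite -Ec; lia.
have -> : t * i.+2 = b * b * i.+2 - a * (i.+2 * c) by lia.
rewrite Ec.
have -> : L - i.+1 = L - i - 1 by lia.
nia.
Qed.

(** * Sums over words of fixed length *)

Section Words.
Local Open Scope ring_scope.
Variables (T : finType) (F : numFieldType).
Implicit Types (f g : seq T -> F).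

(** Peels off the first letter, as [noncrossing] and [fresh] do, so that these unfold under the
    sum. *)
Fixpoint sumw (L : nat) f : F :=
  if L is L'.+1 then \sum_y sumw L' (fun v => f (y :: v)) else f [::].

Lemma eq_sumw L f g : (forall v, size v = L -> f v = g v) -> sumw L f = sumw L g.
Proof.
elim: L f g => [|L IH] f g fg /=; first exact: fg.
by apply: eq_bigr => y _; apply: IH => v sv; apply: fg; rewrite /= sv.
Qed.

Lemma sumwZ L (c : F) f : sumw L (fun v => c * f v) = c * sumw L f.
Proof.
elim: L f => //= L IH f; rewrite mulr_sumr.
by apply: eq_bigr => y _; rewrite IH.
Qed.

Lemma sumwB L f g : sumw L (fun v => f v - g v) = sumw L f - sumw L g.
Proof.
elim: L f g => //= L IH f g; rewrite -sumrB.
by apply: eq_bigr => y _; rewrite IH.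
Qed.

Lemma sumw_sum L (I : finType) (h : I -> seq T -> F) :
  sumw L (fun v => \sum_i h i v) = \sum_i sumw L (h i).
Proof.
elim: L h => //= L IH h; rewrite exchange_big /=.
by apply: eq_bigr => y _; rewrite IH.
Qed.

Lemma ler_norm_sumw L f g : (forall v, size v = L -> `|f v| <= g v) ->
  `|sumw L f| <= sumw L g.
Proof.
elim: L f g => [|L IH] f g fg /=; first exact: fg.
apply: le_trans (ler_norm_sum _ _ _) _; apply: ler_sum => y _.
by apply: IH => v sv; apply: fg; rewrite /= sv.
Qed.

(* Each new letter costs [n^-1] but may be chosen in at most [#|T| <= n] ways. *)
Lemma sumw_fresh_le (n : nat) L (u : {set T}) : (0 < n)%N -> (#|T| <= n)%N ->
  sumw L (fun v => n%:R^-1 ^+ fresh u v) <= (#|u| + L)%:R ^+ L.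
Proof.
move=> n0 Tn; elim: L u => [|L IH] u /=; first by rewrite expr0.
rewrite (bigID (mem u)) /=.
apply: (@le_trans _ _ ((#|u|%:R + 1) * (#|u| + L.+1)%:R ^+ L)); last first.
  rewrite exprS ler_wpM2r ?exprn_ge0 ?ler0n // natr1 ler_nat.
  lia.
rewrite mulrDl mul1r; apply: lerD.
  rewrite mulr_natl -sumr_const; apply: ler_sum => y yu.
  have /setUidPr uy : [set y] \subset u by rewrite sub1set.
  rewrite yu /= uy; apply: le_trans (IH u) _.
  by rewrite lerXn2r ?nnegrE ?ler0n // ler_nat addnS.
apply: (@le_trans _ _ (\sum_(y | y \notin u) n%:R^-1 * (#|u| + L.+1)%:R ^+ L)).
  apply: ler_sum => y yu; rewrite yu /=.
  under eq_sumw => v _ do rewrite exprS.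
  rewrite sumwZ ler_wpM2l ?invr_ge0 ?ler0n //.
  by apply: le_trans (IH _) _; rewrite cardsU1 yu addnS.
rewrite -mulr_suml ler_piMl ?exprn_ge0 ?ler0n //.
rewrite sumr_const -[_ *+ _]mulr_natl ler_pdivrMr ?ltr0n // mul1r ler_nat.
by apply: leq_trans Tn; apply: max_card.
Qed.

(** Returning to each letter of the stack produces every height from 1 to [size S] exactly once, as
    in the recursion of [nc_count]. *)
Lemma sum_pop (G : nat -> F) (S : seq T) : uniq S ->
  \sum_(y <- S) G (size (pop y S)) = \sum_(j < size S) G j.+1.
Proof.
elim: S => [|z S IH] /=; first by rewrite big_nil big_ord0.
case/andP=> zS uS; rewrite big_cons eqxx big_ord_recr /= addrC -IH //.
congr (_ + _); apply: eq_big_seq => y yS.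
by case: eqP => // zy; rewrite zy yS in zS.
Qed.

(** Only the height of the stack matters, and the i new letters are chosen in order outside [u],
    whence the falling factorial. *)
Lemma sumw_noncrossing (n : nat) L (S : seq T) (u : {set T}) :
  uniq S -> {subset S <= u} ->
  sumw L (fun v => (noncrossing S u v)%:R * n%:R^-1 ^+ fresh u v)
  = \sum_(i < L.+1) (nc_count L i (size S) * ((#|T| - #|u|) ^_ i))%:R * n%:R^-1 ^+ i.
Proof.
elim: L S u => [|L IH] S u uS Su.
  by rewrite big_ord1 /= ffactn0 muln1.
rewrite [LHS]/= (bigID (mem S)) /=.
have -> : \sum_(y in S) sumw L (fun v =>
      (if y \in S then noncrossing (pop y S) u v
       else (y \notin u) && noncrossing (y :: S) (y |: u) v)%:R *
       n%:R^-1 ^+ ((y \notin u) + fresh (y |: u) v))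
  = \sum_(i < L.+1) ((\sum_(j < size S) nc_count L i j.+1) * ((#|T| - #|u|) ^_ i))%:R * n%:R^-1 ^+ i.
  rewrite -big_uniq //=.
  transitivity (\sum_(y <- S) \sum_(i < L.+1)
     (nc_count L i (size (pop y S)) * ((#|T| - #|u|) ^_ i))%:R * (n%:R^-1 : F) ^+ i).
    apply: eq_big_seq => y yS.
    have yu := Su _ yS; have /setUidPr uy : [set y] \subset u by rewrite sub1set.
    rewrite yS yu uy IH ?uniq_pop // => z /mem_pop; exact: Su.
  rewrite exchange_big /=; apply: eq_bigr => i _.
  rewrite (sum_pop (fun h => (nc_count L i h * _)%:R * _)) //.
  by rewrite big_distrl /= natr_sum mulr_suml.
have -> : \sum_(y | y \notin S) sumw L (fun v =>
      (if y \in S then noncrossing (pop y S) u v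
       else (y \notin u) && noncrossing (y :: S) (y |: u) v)%:R *
       n%:R^-1 ^+ ((y \notin u) + fresh (y |: u) v))
  = \sum_(i < L.+1) (nc_count L i (size S).+1 * ((#|T| - #|u|) ^_ i.+1))%:R * n%:R^-1 ^+ i.+1.
  (* Letters whose block is already closed contribute nothing. *)
  rewrite (bigID (mem u)) /= big1 ?add0r; last first.
    move=> y /andP[/negPf yS yu]; rewrite yS yu /=.
    by rewrite -[RHS](mul0r (sumw L (fun=> 1))) -sumwZ; apply: eq_sumw => v _; rewrite !mul0r.
  transitivity (\sum_(y | y \notin u) n%:R^-1 * \sum_(i < L.+1)
     (nc_count L i (size S).+1 * ((#|T| - #|u|).-1 ^_ i))%:R * (n%:R^-1 : F) ^+ i).
    apply: eq_big => y.
      rewrite andbC; apply/andb_idr => yu; apply: contra yu; exact: Su.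
    case/andP=> yS yu; rewrite (negPf yS) yu /=.
    have -> : (#|T| - #|u|).-1 = (#|T| - #|y |: u|)%N by rewrite cardsU1 yu; lia.
    rewrite -[X in _ = _ * X](IH (y :: S)) /= ?(negPf yS) //.
      by rewrite -sumwZ; apply: eq_sumw => v _; rewrite exprS mulrCA.
    by move=> z; rewrite !inE => /orP[-> //|/Su ->]; rewrite orbT.
  rewrite sumr_const mulr_sumr -sumrMnl; apply: eq_bigr => i _.
  have -> : #|[pred y | y \notin u]| = (#|T| - #|u|)%N.
    by rewrite -(cardC (mem u)) addKn; apply: eq_card.
  by rewrite ffactnS exprS -mulr_natl !natrM; ring.
rewrite addrC [RHS]big_ord_recl [X in _ + X = _]big_ord_recl /=.
rewrite addrCA add0n; congr (_ + _).
under [RHS]eq_bigr => i _ do rewrite mulnDl natrD mulrDl.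
(* The top term vanishes: L letters cannot open L + 1 blocks. *)
rewrite big_split /=; congr (_ + _); rewrite big_ord_recr /= [X in _ + X](_ : _ = 0) ?addr0 //.
by rewrite big1 ?mul0n ?mul0r // => j _; rewrite nc_count_gt // /bump; lia.
Qed.
End Words.

(** * Edges of closed walks and changes of value *)

Section Edges.
Variable T : eqType.
Implicit Types (x y z : T) (v w : seq T).

Definition edges x w := zip (x :: w) w.

Lemma edges_cat x w1 w2 : edges x (w1 ++ w2) = edges x w1 ++ edges (last x w1) w2.
Proof. by rewrite /edges; elim: w1 x => //= y w1 IH x; rewrite IH. Qed.

Lemma mem_edges x w e : e \in edges x w -> (e.1 \in x :: w) && (e.2 \in w).
Proof.
rewrite /edges; elim: w x => //= y w IH x; rewrite !inE => /orP[/eqP-> /=|/IH].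
  by rewrite !eqxx.
by rewrite !inE => /andP[-> ->]; rewrite !orbT.
Qed.

Lemma path_edges (r : rel T) x w : path r x w = all (fun e => r e.1 e.2) (edges x w).
Proof. by rewrite /edges; elim: w x => //= y w IH x; rewrite IH. Qed.

Lemma unzip2_edges x w : map snd (edges x w) = w.
Proof. by apply: unzip2_zip => /=. Qed.

(** [P] travels backwards along edges: from any letter to the head, which is also the last letter,
    and from there to all letters. *)
Lemma cycle_pred_const (P : pred T) x v :
  {in edges x (rcons v x), forall e, P e.2 -> P e.1} ->
  {in x :: v &, forall y z, P y -> P z}.
Proof.
have to_head w y : {in edges x w, forall e, P e.2 -> P e.1} -> y \in x :: w ->
    P y -> P x.
  rewrite /edges; elim: w x => [|z w IH] x0 /= H; first by rewrite inE => /eqP->.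
  rewrite inE => /orP[/eqP-> //|yw Py].
  apply: (H (x0, z)); first by rewrite inE eqxx.
  by apply: IH yw Py => e ew; apply: H; rewrite inE ew orbT.
have of_last w y : {in edges x w, forall e, P e.2 -> P e.1} -> y \in x :: w ->
    P (last x w) -> P y.
  rewrite /edges; elim: w x y {to_head} => [|z w IH] x0 y /= H.
    by rewrite inE => /eqP->.
  move=> yw Pl.
  have {}IH t : t \in z :: w -> P t.
    by move=> tw; apply: IH tw Pl => e ew; apply: H; rewrite inE ew orbT.
  move: yw; rewrite inE => /orP[/eqP->|/IH //].
  by apply: (H (x0, z)); rewrite ?inE ?eqxx //= IH // inE eqxx.
move=> H y z yv zv Py; apply: (of_last _ z H); last first.
  rewrite last_rcons; apply: to_head H _ Py.
  by rewrite -rcons_cons mem_rcons inE yv orbT.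
by rewrite -rcons_cons mem_rcons inE zv orbT.
Qed.

Lemma not_path_neq x w : ~~ path (fun a b => a != b) x w ->
  exists v1 y v2, x :: w = v1 ++ y :: y :: v2.
Proof.
elim: w x => //= z w IH x; rewrite negb_and negbK => /orP[/eqP->|/IH].
  by exists [::], z, w.
by move=> [v1 [y [v2 ->]]]; exists (x :: v1), y, v2.
Qed.
End Edges.

Section EdgeCount.
Variables T V : finType.

(* Each value [c] of [s] accounts for at least 3 letters or entering edges:
   one letter carrying [c] is entered at least twice, and a class of at least
   two letters is entered at least once. *)
Lemma changing_edges_ge (s : T -> V) x (v : seq T) :
  path (fun a b => a != b) x (rcons v x) ->
  {in x :: v, forall y, 1 < count_mem y (x :: v)} ->
  1 < #|s @: [set z in x :: v]| ->
  3 * #|s @: [set z in x :: v]| <=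
    count (fun e => s e.1 != s e.2) (edges x (rcons v x)) + #|[set z in x :: v]|.
Proof.
set D := [set z in _]; set es := edges _ _ => pth cnt c2.
have DE z : (z \in D) = (z \in rcons v x) by rewrite inE mem_rcons.
(* Each changing edge is charged to the one value it enters. *)
have es_sum : \sum_(c in s @: D) count (fun e => (s e.1 != s e.2) && (s e.2 == c)) es
    <= count (fun e => s e.1 != s e.2) es.
  elim: es => [|e es IH] /=; first by rewrite big1.
  rewrite big_split leq_add //=.
  case: (s e.1 != s e.2) => /=; last by rewrite big1.
  apply: leq_trans (_ : \sum_c (s e.2 == c) <= 1).
    by rewrite big_mkcond leq_sum // => c _; case: ifP.
  by rewrite (bigD1 (s e.2)) //= eqxx big1 // => c; rewrite eq_sym => /negPf ->.
apply: leq_trans (leq_add es_sum (leqnn _)).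
rewrite -[#|D|]sum1_card (partition_big_imset s) /= -big_split /=.
rewrite mulnC -sum_nat_const; apply: leq_sum => _ /imsetP[y yD ->].
rewrite sum1dep_card; set F := [set z | _].
have yF : y \in F by rewrite inE yD /=.
have [F1|F2] := leqP #|F| 1.
  have FE : F = [set y] by apply/esym/eqP; rewrite eqEcard sub1set yF cards1.
  rewrite FE cards1 addn1 ltnS.
  have y2 : 1 < count (fun e => e.2 == y) es.
    have -> : count (fun e => e.2 == y) es = count_mem y (map snd es).
      by rewrite count_map.
    rewrite unzip2_edges -cats1 count_cat /= addn0 addnC.
    by apply: cnt; rewrite inE in yD.
  apply: leq_trans y2 _.
  (* Here [y] is alone in its class and no edge joins [y] to itself, so every edge into [y] changes
     the value. *)
  rewrite -(@eq_in_count _ (fun e => (s e.1 != s e.2) && (s e.2 == s y) && (e.2 == y))).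
    by apply: sub_count => e /= /andP[].
  move=> e ees /=; case: (e.2 =P y) => [ey|]; rewrite ?andbF // andbT ey eqxx andbT.
  move: pth; rewrite path_edges => /allP/(_ _ ees).
  have /andP[e1 _] := mem_edges ees.
  apply: contraNneq => sy; rewrite -in_set1 ey -FE inE DE sy eqxx andbT.
  by move: e1; rewrite -rcons_cons !mem_rcons !inE; case: (e.1 == x).
suff : 0 < count (fun e => (s e.1 != s e.2) && (s e.2 == s y)) es by lia.
(* If no changing edge entered the class, [s] would be constant on the word. *)
rewrite -has_count; apply/contraT => /hasPn noedge.
have H : {in x :: v &, forall z t, s z == s y -> s t == s y}.
  apply: (cycle_pred_const (P := fun z => s z == s y)) => e /noedge.
  by rewrite negb_and negbK => /orP[/eqP->|/negPf->].
move: c2; rewrite ltnNge => /negP[].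
rewrite -(cards1 (s y)); apply: subset_leq_card; apply/subsetP => _ /imsetP[t tD ->].
by rewrite inE; rewrite !inE in tD yD; apply: H tD _ => //.
Qed.
End EdgeCount.

(** * Resampling a letter and counting collisions *)

Section Resample.
Variables T V : finType.
Implicit Types (s : {ffun T -> V}).

Definition upd s y t := [ffun z => if z == y then t else s z].

(** Exchanging [s y] with the independent value [t] is an involution of the pairs (s, t). *)
Lemma sum_resample (F : nmodType) (Phi : {ffun T -> V} -> F) y :
  (\sum_s \sum_t Phi (upd s y t) = (\sum_s Phi s) *+ #|V|)%R.
Proof.
rewrite pair_big /=.
pose h (st : {ffun T -> V} * V) := (upd st.1 y st.2, st.1 y).
have hK : involutive h.
  case=> s t; rewrite /h /= ffunE eqxx; congr pair.
  by apply/ffunP => z; rewrite !ffunE; case: eqP => [->|].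
rewrite (reindex_inj (inv_inj hK)) /=.
under eq_bigr => st _.
  have -> : upd (upd st.1 y st.2) y (st.1 y) = st.1.
    exact: (congr1 fst (hK st)).
  over.
rewrite -(pair_big xpredT xpredT (fun s (t : V) => Phi s)) /= -sumrMnl.
by apply: eq_bigr => s _; rewrite sumr_const.
Qed.

Lemma imset_upd s y t (D : {set T}) : y \notin D ->
  upd s y t @: (y |: D) = t |: s @: D.
Proof.
move=> yD; rewrite imsetU1 ffunE eqxx; congr (_ |: _).
apply: eq_in_imset => z zD; rewrite ffunE.
by case: eqP => // zy; rewrite zy (negPf yD) in zD.
Qed.

(** The weight offsets the rarity of maps with few values, so all image sizes are treated at once.
    The induction resamples one letter of [D]. *)
Lemma sum_collisions_le (D : {set T}) :
  \sum_(s : {ffun T -> V}) #|V| ^ (#|D| - #|s @: D|) <= #|D|`! * #|V| ^ #|T|.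
Proof.
have [k] := ubnP #|D|; elim: k D => // k IH D.
have [->|[y yD]] := set_0Vmem D.
  by move=> _; rewrite cards0 mul1n sum_nat_const card_ffun muln1.
rewrite -(setD1K yD); set D' := D :\ y.
have yD' : y \notin D' by rewrite !inE eqxx.
rewrite cardsU1 yD' /= add1n ltnS => /IH {}IH.
have [V0|V0] := posnP #|V|.
  rewrite big1 // => s _; by have := card0_eq V0 (s y); rewrite !inE.
rewrite -(leq_pmul2r V0).
have <- : \sum_(s : {ffun T -> V}) \sum_t
    #|V| ^ (#|D'|.+1 - #|upd s y t @: (y |: D')|)
  = (\sum_(s : {ffun T -> V}) #|V| ^ (#|D'|.+1 - #|s @: (y |: D')|)) * #|V|.
  rewrite (sum_resample (fun s : {ffun _} => #|V| ^ (#|D'|.+1 - #|s @: (y |: D')|))).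
  by rewrite -mulr_natr natn.
have -> : #|D'|.+1`! * #|V| ^ #|T| * #|V|
    = #|D'|.+1 * #|V| * (#|D'|`! * #|V| ^ #|T|).
  by rewrite factS; ring.
apply: leq_trans (leq_mul (leqnn _) IH).
rewrite big_distrr /=; apply: leq_sum => s _.
under eq_bigr => t _ do rewrite imset_upd // cardsU1.
have le : #|s @: D'| <= #|D'| := leq_imset_card _ _.
(* At most |D'| values of [t] repeat an old one, each costing a factor |V|; at most |V| values are
   new and cost nothing. *)
rewrite (bigID (mem (s @: D'))) /= mulSn mulnDl addnC.
apply: leq_add.
  rewrite -sum_nat_const [X in _ <= X](bigID (mem (s @: D'))) /= -[X in X <= _]add0n.
  apply: leq_add => //; apply: leq_sum => t /negPf ->.
  by rewrite add1n subSS.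
apply: leq_trans (_ : \sum_(t in s @: D') #|V| * #|V| ^ (#|D'| - #|s @: D'|) <= _).
  by apply: leq_sum => t -> /=; rewrite add0n subSn // expnS.
by rewrite sum_nat_const mulnA leq_mul2r leq_mul2r le !orbT.
Qed.
End Resample.

Lemma card_letters_singleton (T : finType) (y : T) v1 v2 : y \notin v1 ++ v2 ->
  #|[set z in v1 ++ y :: v2]| = #|[set z in v1 ++ v2]|.+1.
Proof.
move=> yv; have -> : [set z in v1 ++ y :: v2] = y |: [set z in v1 ++ v2].
  by apply/setP => z; rewrite !inE !mem_cat inE orbCA.
by rewrite cardsU1 inE yv.
Qed.

Lemma card_letters_gt0 (T : finType) (x : T) v : 0 < #|[set z in x :: v]|.
Proof. by apply/card_gt0P; exists x; rewrite !inE eqxx. Qed.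

(** * Moments of cyclic words for an abstract Gram kernel [K], with [q] as the square root of n *)

Section Moments.
Local Open Scope ring_scope.
Variables (F : numFieldType) (T V : finType) (n m : nat) (K : V -> V -> F) (q : F).
Hypotheses (n_gt0 : (0 < n)%N) (m_gt0 : (0 < m)%N) (cardV : #|V| = (m * n)%N).
Hypotheses (q_gt0 : 0 < q) (qq : q ^+ 2 = n%:R) (qm : q <= m%:R).
Hypothesis K_diag : forall t, K t t = 1.
Hypothesis K_offdiag : forall a b, a != b -> `|K a b| <= q^-1.
Hypothesis K_frame : forall a b, \sum_t K a t * K t b = m%:R * K a b.
Implicit Types (s : {ffun T -> V}) (x y : T) (v w : seq T).

Definition walk s x w := \prod_(e <- edges x w) K (s e.1) (s e.2).

Definition moment x v := #|{ffun T -> V}|%:R^-1 * \sum_s walk s x (rcons v x).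

Definition err : F := m%:R^-1 + n%:R^-1.

Lemma walk_cons s x y w : walk s x (y :: w) = K (s x) (s y) * walk s y w.
Proof. by rewrite /walk /edges /= big_cons. Qed.

Lemma walk_nil s x : walk s x [::] = 1.
Proof. by rewrite /walk big_nil. Qed.

Lemma walk_cat s x w1 w2 : walk s x (w1 ++ w2) = walk s x w1 * walk s (last x w1) w2.
Proof. by rewrite /walk edges_cat big_cat. Qed.

Lemma walk_upd s y t x w : y \notin x :: w -> walk (upd s y t) x w = walk s x w.
Proof.
move=> yw; apply: eq_big_seq => e /mem_edges/andP[e1 e2]; rewrite !ffunE.
have -> : e.1 == y = false by apply: contraNF yw => /eqP <-.
have -> // : e.2 == y = false.
by apply: contraNF yw => /eqP <-; rewrite inE e2 orbT.
Qed.

(** Resampling [y] and applying [K_frame] to its two edges gives a factor m, against |V| = mn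
    choices. *)
Lemma walk_remove_singleton y x w1 d w2 : y \notin x :: w1 -> y \notin d :: w2 ->
  \sum_s walk s x (w1 ++ y :: d :: w2) = n%:R^-1 * \sum_s walk s x (w1 ++ d :: w2).
Proof.
move=> y1 y2.
have mn0 : (m * n)%:R != 0 :> F by rewrite pnatr_eq0 -lt0n muln_gt0 m_gt0.
have n0 : n%:R != 0 :> F by rewrite pnatr_eq0 -lt0n.
apply: (mulIf mn0); rewrite mulr_natr -cardV -(sum_resample _ y) cardV.
rewrite mulrAC natrM mulrCA mulVf // mulr1 mulr_sumr; apply: eq_bigr => s _.
have yx : last x w1 == y = false.
  by apply: contraNF y1 => /eqP <-; apply: mem_last.
have yd : d == y = false by apply: contraNF y2 => /eqP ->; rewrite inE eqxx.
rewrite [in RHS]walk_cat walk_cons mulrCA [m%:R * _]mulrA -K_frame mulr_suml mulr_sumr.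
apply: eq_bigr => t _.
rewrite walk_cat !walk_cons !walk_upd // !ffunE eqxx yx yd.
by rewrite !mulrA.
Qed.

(** The error is relative to n^(1-k), so deleting a lone letter scales main term and error alike. *)
Definition moment_spec x v :=
  `|moment x v
     - (noncrossing [:: x] [set x] v)%:R * n%:R^-1 ^+ #|[set z in x :: v]|.-1|
    <= #|[set z in x :: v]|`!%:R * n%:R^-1 ^+ #|[set z in x :: v]|.-1 * err.

Lemma err_ge0 : 0 <= err.
Proof. by rewrite addr_ge0 // invr_ge0 ler0n. Qed.

Lemma cardF_gt0 : 0 < #|{ffun T -> V}|%:R :> F.
Proof. by rewrite ltr0n card_ffun cardV expn_gt0 muln_gt0 m_gt0 n_gt0. Qed.

(** The last factor is the weight of [sum_collisions_le], so the bound can be summed over [s]. *)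
Lemma walk_le s x v :
  path (fun a b => a != b) x (rcons v x) ->
  {in x :: v, forall y, (1 < count_mem y (x :: v))%N} ->
  `|walk s x (rcons v x)| <= n%:R^-1 ^+ #|[set z in x :: v]|.-1 * err *
    (#|V| ^ (#|[set z in x :: v]| - #|s @: [set z in x :: v]|))%:R.
Proof.
set D := [set z in x :: v] => pth cnt.
have n1 : 1 <= n%:R :> F by rewrite ler1n.
have q1 : 1 <= q by rewrite -(@ler_pXn2r _ 2) ?nnegrE ?(ltW q_gt0) ?ler01 ?expr1n ?qq.
have walk_q : `|walk s x (rcons v x)|
    <= q^-1 ^+ count (fun e => s e.1 != s e.2) (edges x (rcons v x)).
  rewrite /walk; elim: (edges _ _) => [|e es IH].
    by rewrite big_nil normr1.
  rewrite big_cons normrM /= exprD ler_pM //.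
  by case: eqVneq => [->|/K_offdiag //]; rewrite K_diag normr1.
have cD : (#|s @: D| <= #|D|)%N := leq_imset_card _ _.
have c0 : (0 < #|s @: D|)%N.
  by apply/card_gt0P; exists (s x); apply: imset_f; rewrite !inE eqxx.
have D2 : (2 <= #|D|)%N.
  rewrite (cardsD1 x) !inE eqxx ltnS card_gt0; apply/set0Pn.
  have [y yv xy] : exists2 y, y \in v & x != y.
    case: v {D cnt walk_q cD c0} pth => [|y v]; first by rewrite /= eqxx.
    by move=> /andP[xy _]; exists y; rewrite // inE eqxx.
  by exists y; rewrite !inE eq_sym xy yv orbT.
apply: le_trans walk_q _.
have n0 : n%:R != 0 :> F by rewrite pnatr_eq0 -lt0n.
have m0 : m%:R != 0 :> F by rewrite pnatr_eq0 -lt0n.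
have m1 : 1 <= m%:R :> F by rewrite ler1n.
have q0 : q != 0 by rewrite gt_eqF.
have qV1 : q^-1 <= 1 by rewrite invf_le1.
have qV0 : 0 <= q^-1 by rewrite invr_ge0 ltW.
rewrite natrX cardV natrM exprMn.
(* For a single value the walk is bounded by 1, and m * err >= 1 makes the right side at least 1. *)
have [c1|c1] := leqP #|s @: D| 1.
  have -> : #|s @: D| = 1%N by apply/eqP; rewrite eqn_leq c1.
  apply: le_trans (exprn_ile1 _ qV0 qV1) _.
  rewrite subn1; case: #|D| D2 => [|[|k]] //= _.
  have -> : n%:R^-1 ^+ k.+1 * err * (m%:R ^+ k.+1 * n%:R ^+ k.+1)
      = (m%:R * err) * m%:R ^+ k :> F.
    have A0 : n%:R ^+ k.+1 != 0 :> F by rewrite expf_neq0.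
    rewrite exprVn [m%:R ^+ k.+1]exprS; move: (n%:R ^+ k.+1) err A0 => A e A0.
    by field.
  rewrite -[X in X <= _]mulr1 ler_pM ?exprn_ege1 //.
  by rewrite /err mulrDr mulfV // lerDl mulr_ge0 ?invr_ge0 ?ler0n.
have := changing_edges_ge pth cnt c1; rewrite -/D => ceD.
set e := count _ _ in ceD *.
(* With c values on k letters, e + (k - c) >= 2c; hence q^-e = q^-(e+k-c) q^(k-c) is at most n^-c
   m^(k-c), using q <= m. *)
apply: (@le_trans _ _ (n%:R^-1 ^+ #|s @: D| * m%:R ^+ (#|D| - #|s @: D|))).
  have -> : q^-1 ^+ e = q^-1 ^+ (e + (#|D| - #|s @: D|)) * q ^+ (#|D| - #|s @: D|).
    by rewrite exprD -mulrA -exprMn mulVf // expr1n mulr1.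
  rewrite ler_pM ?exprn_ge0 ?(ltW q_gt0) //; last first.
    by rewrite lerXn2r ?nnegrE ?(ltW q_gt0) // ler0n.
  rewrite -qq -exprVn -exprM; apply: ler_wiXn2l => //; lia.
have -> : n%:R^-1 ^+ #|s @: D| = n%:R^-1 ^+ #|D| * n%:R ^+ (#|D| - #|s @: D|) :> F.
  rewrite -{1}(subnKC cD) exprD -mulrA -exprMn mulVf // expr1n mulr1 //.
rewrite -[X in X <= _]mulrA [n%:R ^+ _ * m%:R ^+ _]mulrC.
rewrite ler_wpM2r ?mulr_ge0 ?exprn_ge0 ?ler0n //.
rewrite -{1}(prednK (ltnW D2)) exprSr ler_wpM2l ?exprn_ge0 ?invr_ge0 ?ler0n //.
by rewrite /err lerDr invr_ge0 ler0n.
Qed.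

(** A noncrossing word without equal neighbours has a lone letter, so the main term is zero here and
    the whole moment is error. *)
Lemma moment_irreducible x v :
  path (fun a b => a != b) x (rcons v x) ->
  {in x :: v, forall y, (1 < count_mem y (x :: v))%N} ->
  moment_spec x v.
Proof.
move=> pth cnt; rewrite /moment_spec; set D := [set z in x :: v].
have -> : noncrossing [:: x] [set x] v = false.
  apply/negP => /noncrossing_exists_singleton; case=> //.
  - by rewrite inE.
  - by move: pth; rewrite rcons_path => /andP[].
  move=> t t1 _; have /cnt : t \in x :: v by rewrite -has_pred1 has_count t1.
  by rewrite t1.
rewrite mul0r subr0 /moment normrM ger0_norm ?invr_ge0 ?ler0n //.
rewrite mulrC ler_pdivrMr ?cardF_gt0 //.
apply: le_trans (ler_norm_sum _ _ _) _.
apply: le_trans (ler_sum _ (fun s _ => walk_le s pth cnt)) _.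
rewrite -mulr_sumr -natr_sum -/D.
apply: (@le_trans _ _ (n%:R^-1 ^+ #|D|.-1 * err * (#|D|`! * #|V| ^ #|T|)%:R)).
  by rewrite ler_wpM2l ?mulr_ge0 ?err_ge0 ?exprn_ge0 ?invr_ge0 ?ler0n // ler_nat sum_collisions_le.
by rewrite natrM card_ffun [X in _ <= X](_ : _ = n%:R^-1 ^+ #|D|.-1 * err * (#|D|`!%:R * (#|V| ^ #|T|)%:R)) //; ring.
Qed.

Lemma moment_spec_eq x v x' v' : moment x v = moment x' v' ->
  noncrossing [:: x] [set x] v = noncrossing [:: x'] [set x'] v' ->
  x :: v =i x' :: v' -> moment_spec x' v' -> moment_spec x v.
Proof.
move=> E nc mem; rewrite /moment_spec E nc.
by have -> : [set z in x :: v] = [set z in x' :: v']; first by apply/setP => z; rewrite !inE -!in_cons mem.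
Qed.

Lemma moment_spec_singleton x v x' v' : moment x v = n%:R^-1 * moment x' v' ->
  noncrossing [:: x] [set x] v = noncrossing [:: x'] [set x'] v' ->
  #|[set z in x :: v]| = #|[set z in x' :: v']|.+1 ->
  moment_spec x' v' -> moment_spec x v.
Proof.
move=> E nc D spec; rewrite /moment_spec E nc D /=.
move: spec; rewrite /moment_spec; have := card_letters_gt0 x' v'.
case: #|_| => // d _ /= spec.
rewrite exprS; set b := (nat_of_bool _)%:R; rewrite [b * _]mulrCA -mulrBr normrM ger0_norm ?invr_ge0 ?ler0n //.
rewrite [d.+2`!%:R * _]mulrCA -[X in _ <= X]mulrA ler_wpM2l ?invr_ge0 ?ler0n //.
apply: le_trans spec _.
rewrite !ler_wpM2r ?err_ge0 ?exprn_ge0 ?invr_ge0 ?ler0n // ler_nat.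
by rewrite [d.+2`!]factS leq_pmull.
Qed.

Lemma moment_singleton x v1 y v2 : y \notin x :: v1 ++ v2 ->
  moment x (v1 ++ y :: v2) = n%:R^-1 * moment x (v1 ++ v2).
Proof.
rewrite inE mem_cat !negb_or => /and3P[yx y1 y2].
rewrite /moment mulrCA !rcons_cat /=; congr (_ * _).
have : y \notin rcons v2 x by rewrite mem_rcons inE negb_or yx.
have : rcons v2 x != [::] by case: (v2).
case: (rcons v2 x) => // d w _ yw.
by apply: walk_remove_singleton => //; rewrite inE negb_or yx.
Qed.

Lemma moment_rot x y v : moment x (y :: v) = moment y (rcons v x).
Proof.
congr (_ * _); apply: eq_bigr => s _.
by rewrite rcons_cons walk_cons -(cats1 (rcons v x)) walk_cat last_rcons walk_cons walk_nil mulr1 mulrC.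
Qed.

(** Induction on length: contract cyclically adjacent equal letters, else delete a lone letter, else
    the word is irreducible. *)
Lemma moment_asymptotics x v : moment_spec x v.
Proof.
have [k] := ubnP (size v); elim: k x v => // k IH x v; rewrite ltnS => vk.
have [pth|] := boolP (path (fun a b => a != b) x (rcons v x)).
  have [/allP|/allPn[y yv]] := boolP (all (fun y => 1 < count_mem y (x :: v))%N (x :: v)).
    exact: moment_irreducible.
  rewrite -leqNgt => y1.
  (* A lone head is rotated to the end before deletion, leaving its successor as head. *)
  have [yx|yx] := eqVneq y x.
    have xv : x \notin v by rewrite -has_pred1 has_count -leqNgt; move: y1; rewrite yx /= eqxx.
    case: v pth xv vk {yv y1} => [|z v] pth xv vk; first by rewrite /= eqxx in pth.
    apply: (moment_spec_singleton (x' := z) (v' := v)) (IH _ _ vk).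
    - by rewrite moment_rot -cats1 moment_singleton ?cats0.
    (* Reading from the empty stack puts the head inside the word, where [noncrossing_singleton]
       applies. *)
    - have nc : noncrossing [::] set0 (x :: z :: v) = noncrossing [::] set0 (z :: v).
        by apply: (@noncrossing_singleton _ x [::] set0 [::]); rewrite ?in_set0.
      by move: nc; rewrite [LHS]/= [RHS]/= !in_set0 !setU0.
    - by have := @card_letters_singleton _ x [::] (z :: v); apply.
  move: yv; rewrite inE (negPf yx) /= => yv.
  case/splitPr: v / yv y1 vk {pth} => v1 v2 y1 vk.
  have {y1} yv : y \notin x :: v1 ++ v2.
    rewrite -has_pred1 has_count -leqNgt; move: y1.
    by rewrite /= !count_cat /= eqxx; lia.
  have vk' : (size (v1 ++ v2) < k)%N by move: vk; rewrite !size_cat /= addnS.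
  apply: (moment_spec_singleton (x' := x) (v' := v1 ++ v2)) (IH _ _ vk').
  - exact: moment_singleton.
  - by move: yv; rewrite inE negb_or => /andP[yv1 yv2]; apply: noncrossing_singleton; rewrite ?inE.
  - exact: (@card_letters_singleton _ y (x :: v1)).
rewrite rcons_path negb_and negbK => /orP[/not_path_neq|/eqP].
  case=> [[|x' v1] [y [v2]]] [].
    move=> <-; case: v vk => [|z v] vk // [-> _] {y v2}.
    apply: (moment_spec_eq (x' := x) (v' := v)) (IH _ _ vk).
    - congr (_ * _); apply: eq_bigr => s _.
      by rewrite rcons_cons walk_cons K_diag mul1r.
    - by rewrite /= mem_seq1 !eqxx.
    - by move=> t; rewrite !inE orbA orbb.
  move=> _ E; rewrite {v}E in vk *.
  have vk' : (size (v1 ++ y :: v2) < k)%N by move: vk; rewrite !size_cat /= !addnS.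
  apply: (moment_spec_eq (x' := x) (v' := v1 ++ y :: v2)) (IH _ _ vk').
  - congr (_ * _); apply: eq_bigr => s _.
    by rewrite !rcons_cat !rcons_cons !walk_cat !walk_cons K_diag mul1r.
  - exact: noncrossing_dup.
  - by move=> t; rewrite !inE !mem_cat !inE; case: (t == y); rewrite ?orbT.
(* The last letter equals the head; for [v] empty this is the one-letter word, of moment exactly
   1. *)
case/lastP: v vk => [_ _|v z].
  rewrite /moment_spec /moment /=.
  have -> : #|[set z in [:: x]]| = 1%N by rewrite -(cards1 x); apply: eq_card => z; rewrite !inE.
  under eq_bigr => s _ do rewrite walk_cons walk_nil K_diag mulr1.
  rewrite sumr_const -[1 *+ _]/(_%:R) mulVf ?gt_eqF ?cardF_gt0 //.
  by rewrite expr0 mulr1 subrr normr0 mul1r err_ge0.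
rewrite size_rcons last_rcons => vk ->.
apply: (moment_spec_eq (x' := x) (v' := v)) (IH _ _ vk).
- congr (_ * _); apply: eq_bigr => s _.
  by rewrite -(cats1 (rcons v x)) walk_cat last_rcons walk_cons K_diag walk_nil !mulr1.
- by rewrite (noncrossing_rcons_bottom [::]).
- by move=> t; rewrite !inE mem_rcons inE orbA orbb.
Qed.
End Moments.

(** * Matrix powers as walks, and falling factorials against powers *)

Local Open Scope ring_scope.
Local Open Scope complex_scope.

Lemma expmx_sumw (F : numFieldType) p (G : 'M[F]_p) L x z :
  (G ^+ L.+1) x z = sumw L (fun v => \prod_(e <- edges x (rcons v z)) G e.1 e.2).
Proof.
elim: L x => [|L IH] x /=; first by rewrite expr1 /edges /= big_seq1.
rewrite exprS mxE; apply: eq_bigr => y _; rewrite IH -sumwZ.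
by apply: eq_sumw => v _; rewrite [in RHS]/edges /= big_cons.
Qed.

(** The successive factors of the falling factorial fall short of p by at most 1, ..., i, the other
    factors are at most n, and 1 + ... + i <= i^2. *)
Lemma ffact_pred_approx p n i : (p <= n)%N ->
  (p ^ i * n <= p.-1 ^_ i * n + i ^ 2 * n ^ i)%N.
Proof.
move=> pn; elim: i => [|i IH]; first by rewrite ffactn0 expn0 leq_addr.
have ab : (p.-1 ^_ i <= n ^ i)%N.
  by elim: i {IH} => // i IHi; rewrite ffactnSr expnSr leq_mul //; lia.
rewrite ffactnSr !expnS expn0 muln1 in IH *.
move: (p.-1 ^_ i)%N (n ^ i)%N (p ^ i)%N IH ab => a b c IH ab.
have p_split : (p <= (p.-1 - i) + i.+1)%N by lia.
have h1 : (p * c * n <= p * (a * n) + n * (i * i * b))%N.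
  apply: leq_trans (_ : p * (a * n + i * i * b) <= _)%N.
    by rewrite -mulnA leq_mul2l IH orbT.
  by rewrite mulnDr leq_add2l leq_mul2r pn orbT.
have h2 : (p * (a * n) <= (p.-1 - i + i.+1) * (a * n))%N by rewrite leq_mul2r p_split orbT.
have h3 : (i.+1 * (a * n) <= i.+1 * (b * n))%N by rewrite leq_mul2l leq_mul2r ab !orbT.
nia.
Qed.

Lemma ffact_pred_le p i : (p.-1 ^_ i <= p ^ i)%N.
Proof. by elim: i => // i IHi; rewrite ffactnSr expnSr leq_mul //; lia. Qed.

(** * The union of the bases as a tight frame *)

Section Frame.
Variables (R : realType) (n m : nat) (B : 'I_m -> 'I_n -> 'rV[R[i]]_n).
Hypothesis B_mub : mutually_unbiased B.

Definition vec (t : 'I_m * 'I_n) := B t.1 t.2.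

(** Orthonormality says U U* = 1; for a square matrix this gives U* U = 1, the resolution of the
    identity. *)
Lemma orthonormal_basis_frame (b : 'I_n -> 'rV[R[i]]_n) (u v : 'rV_n) :
  orthonormal_basis b -> \sum_k hinner u (b k) * hinner (b k) v = hinner u v.
Proof.
move=> ob; pose U : 'M[R[i]]_n := \matrix_(k, j) b k 0 j.
pose Uh : 'M[R[i]]_n := \matrix_(j, k) (b k 0 j)^*.
pose vh : 'cV[R[i]]_n := \col_j (v 0 j)^*.
have UhU : Uh *m U = 1%:M.
  apply: mulmx1C; apply/matrixP => k k'; rewrite !mxE -ob.
  by apply: eq_bigr => j _; rewrite !mxE.
have hE (w : 'rV_n) : hinner w v = (w *m vh) 0 0.
  by rewrite mxE; apply: eq_bigr => j _; rewrite !mxE.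
rewrite hE -[u in RHS]mulmx1 -UhU mulmxA -mulmxA mxE.
apply: eq_bigr => k _; rewrite hE; congr (_ * _); rewrite !mxE.
  by apply: eq_bigr => j _; rewrite !mxE.
by apply: eq_bigr => j _; rewrite !mxE.
Qed.

Lemma vec_frame s t : \sum_r hinner (vec s) (vec r) * hinner (vec r) (vec t)
  = m%:R * hinner (vec s) (vec t).
Proof.
rewrite -(pair_big xpredT xpredT (fun i k =>
  hinner (vec s) (B i k) * hinner (B i k) (vec t))) /=.
under eq_bigr => i _ do rewrite (orthonormal_basis_frame _ _ (proj1 B_mub i)).
by rewrite sumr_const card_ord mulr_natl.
Qed.

Lemma hinner_vec_diag t : hinner (vec t) (vec t) = 1.
Proof. by rewrite (proj1 B_mub) eqxx. Qed.

Lemma norm_hinner_vec s t : s != t ->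
  `|hinner (vec s) (vec t)| <= (sqrtC (n%:R : R[i]))^-1.
Proof.
case: s t => [i k] [j k'] st; rewrite /vec /=.
have [ij|ij] := eqVneq i j; last by rewrite (proj2 B_mub) // div1r.
rewrite ij (proj1 B_mub); have -> : k == k' = false.
  by apply: contraNF st => /eqP ->; rewrite ij.
by rewrite normr0 invr_ge0 sqrtC_ge0 ler0n.
Qed.

Lemma expect_AlE p L : expect_Al p B L.+1 = p%:R^-1 *
  \sum_(x < p) sumw L (moment (fun s t => hinner (vec s) (vec t)) x).
Proof.
rewrite /expect_Al /A_l -mulr_sumr mulrCA; congr (_ * _).
rewrite /mxtrace exchange_big mulr_sumr; apply: eq_bigr => x _.
rewrite /moment sumwZ sumw_sum; congr (_ * _); apply: eq_bigr => s _.
rewrite expmx_sumw; apply: eq_sumw => v _; apply: eq_bigr => e _.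
by rewrite mxE.
Qed.
End Frame.

(** * The Narayana main term and the final estimate *)

Lemma main_termE (R : realType) (y : R[i]) L :
  main_term y L.+1 = \sum_(i < L.+1) (nc_count L i 1)%:R * y ^+ i.
Proof.
apply: eq_bigr => i _; have iL : (i <= L)%N by rewrite -ltnS.
rewrite -mulrA -natrM /= -nc_count_narayana // natrM.
have : i.+1%:R != 0 :> R[i] by rewrite pnatr_eq0.
by move: (i.+1%:R) => a a0; field.
Qed.

Theorem theorem2 (R : realType) (l : nat) (hl : (0 < l)%N) :
  exists K : R, forall (n m p : nat) (B : 'I_m -> 'I_n -> 'rV[R[i]]_n),
    (2 <= n)%N -> (2 <= m)%N -> (n <= m * m)%N ->
    mutually_unbiased B ->
    (0 < p)%N -> (p < n)%N ->
    `| expect_Al p B l - main_term (p%:R / n%:R) l |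
      <= K%:C * ((m%:R)^-1 + (n%:R)^-1).
Proof.
case: l hl => // L _.
(* A word has at most L + 1 letters, whence the factorial; the power is the bound of [sumw_fresh_le]
   with one letter already met. *)
pose K0 := (L.+1`! * L.+1 ^ L)%N.
(* The cost of replacing falling factorials by powers of p, from [ffact_pred_approx]. *)
pose K1 := (\sum_(i < L.+1) nc_count L i 1 * i ^ 2)%N.
exists (K0 + K1)%:R => n m p B n2 m2 nm mub p0 pn.
have n_gt0 : (0 < n)%N by apply: ltnW.
have m_gt0 : (0 < m)%N by apply: ltnW.
rewrite rmorph_nat; set C := R[i].
have n0 : (n%:R : C) != 0 by rewrite pnatr_eq0 -lt0n.
have pC0 : (p%:R : C) != 0 by rewrite pnatr_eq0 -lt0n.
have nV0 : 0 <= (n%:R : C)^-1 by rewrite invr_ge0 ler0n.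
pose err : C := m%:R^-1 + n%:R^-1; rewrite -/err.
have err0 : 0 <= err by rewrite addr_ge0 // invr_ge0 ler0n.
(* The exact noncrossing contribution for any fixed first letter, which leaves p - 1 letters to
   choose from. *)
pose mid : C := \sum_(i < L.+1) (nc_count L i 1 * (p.-1 ^_ i))%:R * n%:R^-1 ^+ i.
have midE x : mid = sumw L (fun v : seq 'I_p =>
    (noncrossing [:: x] [set x] v)%:R * n%:R^-1 ^+ fresh [set x] v).
  rewrite sumw_noncrossing //= ?cards1 ?card_ord ?subn1 //.
  by move=> z; rewrite !inE.
have pred_fresh (x : 'I_p) v : #|[set z in x :: v]|.-1 = fresh [set x] v.
  have -> : [set z in x :: v] = [set x] :|: [set z in v].
    by apply/setP => z; rewrite !inE.
  by rewrite fresh_card cards1.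
have spec (x : 'I_p) v : moment_spec n m (fun s t => hinner (vec B s) (vec B t)) x v.
  apply: (@moment_asymptotics _ _ _ n m _ (sqrtC n%:R)) => //.
  - by rewrite card_prod !card_ord.
  - by rewrite sqrtC_gt0 ltr0n.
  - by rewrite sqrtCK.
  - rewrite -(@ler_pXn2r _ 2) ?nnegrE ?sqrtC_ge0 ?ler0n // sqrtCK -natrX ler_nat.
    by rewrite -mulnn.
  - exact: hinner_vec_diag.
  - exact: norm_hinner_vec.
  - exact: vec_frame.
have dist1 : `|expect_Al p B L.+1 - mid| <= K0%:R * err.
  have -> : expect_Al p B L.+1 - mid = p%:R^-1 * \sum_(x < p)
      (sumw L (moment (fun s t => hinner (vec B s) (vec B t)) x) - mid).
    rewrite expect_AlE sumrB sumr_const card_ord mulrBr -[mid *+ p]mulr_natl.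
    by rewrite mulKf.
  rewrite normrM ger0_norm ?invr_ge0 ?ler0n // mulrC ler_pdivrMr ?ltr0n //.
  apply: le_trans (ler_norm_sum _ _ _) _.
  have -> : K0%:R * err * p%:R = \sum_(x < p) K0%:R * err.
    by rewrite sumr_const card_ord mulr_natr.
  apply: ler_sum => x _; rewrite (midE x) -sumwB.
  apply: (@le_trans _ _ (sumw L (fun v => L.+1`!%:R * err * n%:R^-1 ^+ fresh [set x] v))).
    apply: ler_norm_sumw => v sv.
    move: (spec x v); rewrite /moment_spec pred_fresh => /le_trans; apply.
    rewrite [X in _ <= X]mulrAC !ler_wpM2r ?exprn_ge0 // ler_nat.
    by rewrite leq_fact // cardsE (leq_trans (card_size _)) //= sv.
  rewrite sumwZ /K0 natrM natrX [X in _ <= X]mulrAC ler_wpM2l ?mulr_ge0 ?ler0n //.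
  have := @sumw_fresh_le _ C n L [set x] n_gt0.
  by rewrite card_ord cards1 add1n; apply; apply: ltnW.
have dist2 : `|mid - main_term (p%:R / n%:R) L.+1| <= K1%:R * n%:R^-1.
  rewrite main_termE -sumrB natr_sum mulr_suml.
  apply: le_trans (ler_norm_sum _ _ _) _; apply: ler_sum => i _.
  rewrite !natrM -!mulrA -mulrBr normrM normr_nat ler_wpM2l ?ler0n //.
  rewrite expr_div_n -[_ / n%:R ^+ i]/(_ * _) -exprVn -mulrBl.
  rewrite normrM distrC -natrX -natrB ?ffact_pred_le // normr_nat ger0_norm ?exprn_ge0 // exprVn ler_pdivrMr ?exprn_gt0 ?ltr0n //.
  rewrite [i%:R * _]mulrA mulrAC ler_pdivlMr ?ltr0n // -[n%:R ^+ i]natrX -!natrM ler_nat mulnBl leq_subLR.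
  exact/ffact_pred_approx/ltnW.
rewrite -(subrKA mid) natrD mulrDl; apply: le_trans (ler_normD _ _) _.
apply: lerD => //; apply: le_trans dist2 _.
by rewrite ler_wpM2l ?ler0n // lerDr invr_ge0 ler0n.
Qed.
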